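(* Let $R$ be a commutative ring with identity, let $n\ge 1$, and let $A_n=(a_{ij})$ be an $n\times n$ lower Hessenberg matrix over $R$, i.e. $a_{ij}=0$ whenever $j-i>1$. Let $B_n=(b_{ij})$ be the $n\times n$ lower Hessenberg matrix with $$b_{ij}=\begin{cases}0 & \text{if } j-i>1,\\ -a_{ij} & \text{if } j-i=1,\\ a_{ij} & \text{otherwise.}\end{cases}$$ Then $\det(B_n)=\operatorname{per}(A_n)$ and $\det(A_n)=\operatorname{per}(B_n)$.
   Context: The permanent of an $n\times n$ matrix $A=(a_{ij})$ is $\operatorname{per}(A)=\sum_{\sigma\in S_n}\prod_{i=1}^n a_{i,\sigma(i)}$, where $S_n$ is the symmetric group on $n$ letters. *)

(* Defs.v *)
From mathcomp Require Import all_boot all_order all_algebra all_fingroup.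
Set Implicit Arguments.
Unset Strict Implicit.
Unset Printing Implicit Defensive.
Import GRing.Theory.
Local Open Scope ring_scope.

Definition permanent (R : comPzRingType) (n : nat) (A : 'M[R]_n) : R :=
  \sum_(s : 'S_n) \prod_(i < n) A i (s i).

(* The condition j - i > 1 is written i + 1 < j, avoiding the truncated
   subtraction of nat. *)
Definition lower_hessenberg (R : comPzRingType) (n : nat) (A : 'M[R]_n) : Prop :=
  forall i j : 'I_n, (i.+1 < j)%N -> A i j = 0.

Definition opp_superdiag (R : comPzRingType) (n : nat) (A : 'M[R]_n) : 'M[R]_n :=
  \matrix_(i, j)
    if (i.+1 < j)%N then 0
    else if (j == i.+1 :> nat) then - A i j
    else A i j.

(* Main.v *)
Require Import Defs.
From mathcomp Require Import all_boot all_order all_algebra all_fingroup.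
Local Open Scope ring_scope.

(** Expand both sides as sums over permutations.  All entries above the
    superdiagonal vanish, so a permutation [s] matters only if [s i <= i + 1]
    for all [i].  Call [i] a rise of [s] if [s i = i + 1].  Negating the
    superdiagonal multiplies the product of [s] by [-1] to the number of rises,
    and for such [s] this sign is the signature ([odd_perm_hessenberg]): since
    a cycle can go up only by one at a time, it passes through every value
    between its smallest and its largest one and rises from each of them but
    the largest, so a cycle of length [m] has [m - 1] rises, which is the
    parity of an [m]-cycle.  (The formal proof gets the same count by removing
    the first row.)  So the signs of the determinant cancel and the permanent
    is left.

    Negating the superdiagonal twice gives back the matrix, so the second
    identity is the first one applied to the modified matrix. *)

Import GRing.Theory.

Lemma lift_perm_surj n (i : 'I_n.+1) (s : 'S_n.+1) :
  exists t : 'S_n, s = lift_perm i (s i) t.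
Proof.
have neq k : s i != s (lift i k) by rewrite (inj_eq perm_inj) neq_lift.
pose f k := s2val (unlift_some (neq k)).
have fE k : s (lift i k) = lift (s i) (f k) := s2valP (unlift_some (neq k)).
have f_inj : injective f.
  by move=> j k fjk; apply: (@lift_inj _ i); apply: (@perm_inj _ s); rewrite !fE fjk.
exists (perm f_inj); apply/permP => k.
case: (unliftP i k) => [j|] ->; last by rewrite lift_perm_id.
by rewrite lift_perm_lift permE fE.
Qed.

(** Induct by deleting row 0 and column [s 0], where [s 0] is 0 or 1.  The
    index of every other row drops by one, and so does that of every other
    column except possibly column 0; but a row other than 0 neither violates
    the bound nor rises at column 0, before or after the deletion.  Thus the
    smaller permutation satisfies the hypothesis and keeps the rises of [s] in
    the remaining rows.  Row 0 is a rise exactly if [s 0 = 1], and the deleted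
    corner contributes the parity of [0 + s 0] to the signature. *)
Lemma odd_perm_hessenberg n (s : 'S_n) :
  (forall i, (s i <= i.+1)%N) ->
  odd_perm s = odd (\sum_(i < n) (s i == i.+1 :> nat))%N.
Proof.
elim: n s => [|n IHn] s hs.
  by rewrite big_ord0 (_ : s = 1%g) ?odd_perm1 //; apply/permP => -[].
have [t Es] := lift_perm_surj n ord0 s.
have s0_le1 : (s ord0 <= 1)%N := hs ord0.
have sS k : s (lift ord0 k) = lift (s ord0) (t k).
  by rewrite [in LHS]Es lift_perm_lift.
have sS_eq k : (s (lift ord0 k) == (lift ord0 k).+1 :> nat) = (t k == k.+1 :> nat).
  rewrite sS /= /bump /=.
  by case: (s ord0 : nat) s0_le1 => [|[|//]] _; case: (t k : nat).
have ht k : (t k <= k.+1)%N.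
  have := hs (lift ord0 k); rewrite sS /= /bump /=.
  by case: (s ord0 : nat) s0_le1 => [|[|//]] _; case: (t k : nat).
rewrite big_ord_recl oddD {1}Es odd_lift_perm (IHn t ht).
under [in RHS]eq_bigr do rewrite sS_eq.
by case: (s ord0 : nat) s0_le1 => [|[|//]].
Qed.

Lemma opp_superdiag_sign (R : comPzRingType) n (A : 'M[R]_n) i j :
  lower_hessenberg A ->
  opp_superdiag A i j = (-1) ^+ (j == i.+1 :> nat) * A i j.
Proof.
move=> hA; rewrite mxE; case: ltnP => [lt_ij|_]; first by rewrite hA ?mulr0.
by case: eqP => _; rewrite ?expr1 ?mulN1r ?expr0 ?mul1r.
Qed.

Lemma opp_superdiag_hessenberg (R : comPzRingType) n (A : 'M[R]_n) :
  lower_hessenberg (opp_superdiag A).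
Proof. by move=> i j lt_ij; rewrite mxE lt_ij. Qed.

Lemma opp_superdiagK (R : comPzRingType) n (A : 'M[R]_n) :
  lower_hessenberg A -> opp_superdiag (opp_superdiag A) = A.
Proof.
move=> hA; apply/matrixP => i j.
rewrite (opp_superdiag_sign _ _ _ _ _ (opp_superdiag_hessenberg _ _ A)).
by rewrite opp_superdiag_sign // signrMK.
Qed.

Lemma det_opp_superdiag (R : comPzRingType) n (A : 'M[R]_n) :
  lower_hessenberg A -> \det (opp_superdiag A) = permanent A.
Proof.
move=> hA; apply: eq_bigr => s _.
under eq_bigr do rewrite opp_superdiag_sign //.
rewrite big_split /= -expr_sum.
(* A permutation that breaks the bound meets a zero entry in both sums. *)
have [/forallP hs|/forallPn [i]] := boolP [forall i, (s i <= i.+1)%N].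
  by rewrite odd_perm_hessenberg // signr_odd signrMK.
rewrite -ltnNge => /hA Ai0.
have -> : \prod_(k < n) A k (s k) = 0 by rewrite (bigD1 i) //= Ai0 mul0r.
by rewrite !mulr0.
Qed.

Theorem theorem3p8 (R : comPzRingType) (n : nat) (hn : (1 <= n)%N)
    (A : 'M[R]_n) (hA : lower_hessenberg A) :
  \det (opp_superdiag A) = permanent A /\ \det A = permanent (opp_superdiag A).
Proof.
split; first exact: det_opp_superdiag.
rewrite -[in LHS](opp_superdiagK _ _ A hA).
exact/det_opp_superdiag/opp_superdiag_hessenberg.
Qed.
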